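(* Let $A$ be an algebraic information system and let $r$ be an approximable mapping from $A$ to $A$ such that $|r|:|A|\to|A|$ is a retraction. Then the following conditions are equivalent: (1) $|r|$ is finitary. (2) For all $u,w\in\mathcal P_{\rm fin}(D_A)$, if $u\,r\,w$ then there is $v\in\mathcal P_{\rm fin}(D_A)$ such that $u\,r\,v$, $v\,r\,v$ and $v\,r\,w$. (3) For all $u,w\in\mathcal P_{\rm fin}(D_A)$, if $u\,r\,w$ then there is $v\in\mathcal P_{\rm fin}(D_A)$ such that $u\,r\,v$, $v\,r\,v$ and $v\vdash_A w$.
   Context: For a set $D$, $\mathcal P_{\rm fin}(D)$ denotes the set of its finite subsets. An algebraic information system is a triple $A=(D_A,\nabla_A,\vdash_A)$ with $D_A$ a set, $\nabla_A\in D_A$, and $\vdash_A\subseteq \mathcal P_{\rm fin}(D_A)\times\mathcal P_{\rm fin}(D_A)$ such that for all finite sets: (1) $\emptyset\not\vdash_A\{\nabla_A\}$; (2) $v\subseteq u$ implies $u\vdash_A v$; (3) $u\vdash_A v_1,\dots,u\vdash_A v_n$ and $v_1\cup\dots\cup v_n\vdash_A w$ imply $u\vdash_A w$; (4) $\{\nabla_A\}\vdash_A u$. The domain $|A|$ is the set of all $x\subseteq D_A$ with $\nabla_A\notin x$ such that $u\subseteq x$ finite and $u\vdash_A v$ imply $v\subseteq x$; it is ordered by inclusion. An approximable mapping from $A$ to $A$ is a relation $r\subseteq\mathcal P_{\rm fin}(D_A)\times\mathcal P_{\rm fin}(D_A)$ such that: (1) $\emptyset\, r\,\emptyset$; (2)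 $u\not\vdash_A\{\nabla_A\}$ implies $\neg(u\,r\,\{\nabla_A\})$; (3) $\{\nabla_A\}\,r\,\{\nabla_A\}$; (4) $u\,r\,v_1,\dots,u\,r\,v_n$ imply $u\,r\,(v_1\cup\dots\cup v_n)$; (5) $u'\vdash_A u$, $u\,r\,v$, $v\vdash_A v'$ imply $u'\,r\,v'$. The associated (Scott continuous) function is $|r|(x)=\{d\in D_A\mid \exists u\subseteq x \text{ finite},\ u\,r\,\{d\}\}$. $|r|$ is a retraction if $|r|\circ|r|=|r|$. A retraction is finitary if its set of fixed points, with the order of $|A|$, is algebraic, i.e. it is a directed complete partial order in which every element is the supremum of a directed set of compact elements (those below it). *)

(* Defs.v *)
From HB Require Import structures.
From mathcomp Require Import all_boot all_order finmap.
From mathcomp Require Import boolp classical_sets.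

Set Implicit Arguments.
Unset Strict Implicit.
Unset Printing Implicit Defensive.

Import Order.TTheory.
Local Open Scope fset_scope.
Local Open Scope classical_set_scope.
Local Open Scope order_scope.

(* A subset [A] of a poset, seen as a type via the coercion [set_type], is
   ordered by the restriction of the ambient order. *)
HB.instance Definition _ (T : choiceType) (A : set T) :=
  SubChoice.copy (set_type A) {x : T | x \in A}.
HB.instance Definition _ (d : Order.disp_t) (T : porderType d) (A : set T) :=
  [SubChoice_isSubPOrder of set_type A by <: with d].

Section Posets.
Context {d : Order.disp_t} {T : porderType d}.
Implicit Types (M : set T) (c s x : T).

(* [supremums M] is the set of least upper bounds of [M], hence it is empty or
   a singleton. *)

Definition directed M : Prop :=
  M !=set0 /\
  forall x y, M x -> M y -> exists z, [/\ M z, x <= z & y <= z].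

Definition compact_elt c : Prop :=
  forall M s, directed M -> supremums M s -> c <= s -> exists2 m, M m & c <= m.

Definition compacts_below x : set T := [set c | compact_elt c /\ c <= x].

End Posets.

Definition dcpo {d : Order.disp_t} (T : porderType d) : Prop :=
  forall M : set T, directed M -> exists s, supremums M s.

Definition algebraic {d : Order.disp_t} (T : porderType d) : Prop :=
  dcpo T /\
  forall x : T, directed (compacts_below x) /\ supremums (compacts_below x) x.

(* The tokens form a [choiceType] only so that finite sets of tokens can be
   taken in [{fset _}]; classically every type carries such a structure. *)
Record infosys := InfoSys {
  token :> choiceType;
  nabla : token;
  entails : {fset token} -> {fset token} -> Prop;
  entails_consistent : ~ entails fset0 [fset nabla];
  entails_sub : forall u v : {fset token}, (v `<=` u)%fset -> entails u v;
  entails_trans : forall (u : {fset token}) (vs : seq {fset token})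
      (w : {fset token}),
    (forall v, v \in vs -> entails u v) ->
    entails (\bigcup_(v <- vs) v)%fset w -> entails u w;
  entails_nabla : forall u : {fset token}, entails [fset nabla] u }.

Arguments nabla {_}.
Arguments entails {_} _ _.

Definition is_elt (A : infosys) : set (set A) :=
  [set x | ~ x nabla /\
     forall u v : {fset A}, [set` u] `<=` x -> entails u v -> [set` v] `<=` x].

(* The order of [domain A] is inherited from [set A], where it is inclusion. *)
Definition domain (A : infosys) := set_type (@is_elt A).
HB.instance Definition _ (A : infosys) := Order.POrder.on (domain A).

Record approximable (A : infosys) := Approximable {
  amap :> {fset A} -> {fset A} -> Prop;
  amap0 : amap fset0 fset0;
  amap_consistent : forall u,
    ~ entails u [fset nabla] -> ~ amap u [fset nabla];
  amap_nabla : amap [fset nabla] [fset nabla];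
  amap_bigcup : forall u (vs : seq {fset A}),
    (forall v, v \in vs -> amap u v) -> amap u (\bigcup_(v <- vs) v)%fset;
  amap_entails : forall u' u v v',
    entails u' u -> amap u v -> entails v v' -> amap u' v' }.

Section AssociatedFunction.
Context {A : infosys} (r : approximable A).

Definition image_set (x : set A) : set A :=
  [set t | exists2 u : {fset A}, [set` u] `<=` x & r u [fset t]].

Lemma image_set_finite (x : set A) (v : {fset A}) :
  [set` v] `<=` image_set x -> exists2 u : {fset A}, [set` u] `<=` x & r u v.
Proof.
move=> vx.
have /choice[f fP] : forall t, exists u : {fset A},
    t \in v -> [set` u] `<=` x /\ r u [fset t].
  move=> t; case: (boolP (t \in v)) => [/vx[u ux ru]|_]; first by exists u.
  by exists fset0.
have vE : v = (\bigcup_(w <- [seq [fset t] | t <- v]) w)%fset.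
  apply/fsetP => t; rewrite big_map; apply/idP/bigfcupP => [tv|[s]].
    by exists t; rewrite ?tv ?inE.
  by rewrite andbT => sv; rewrite inE => /eqP ->.
exists (\bigcup_(t <- v) f t)%fset.
  move=> s /bigfcupP[t]; rewrite andbT => tv sf.
  by have [fx _] := fP t tv; exact: fx.
rewrite [v in r _ v]vE; apply: amap_bigcup => _ /mapP[t tv ->].
have [_ rft] := fP t tv; apply: amap_entails rft _; apply: entails_sub => //.
by apply: (@bigfcup_sup _ _ _ t).
Qed.

Lemma image_set_is_elt (x : domain A) : is_elt (image_set (val x)).
Proof.
have [xN xcl] : is_elt (val x) := set_mem (valP x).
split=> [[u ux ru]|u v /image_set_finite[u' ux' ru'] uv t tv].
  apply: (@amap_consistent _ r u) => // uN; apply: xN.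
  by apply: (xcl u [fset nabla]) => //=; rewrite inE.
exists u' => //; apply: amap_entails ru' _; first exact: entails_sub.
apply: (entails_trans (vs := [:: v])) => [w|]; first by rewrite inE => /eqP ->.
by rewrite big_seq1; apply: entails_sub; rewrite fsub1set.
Qed.

Definition afun (x : domain A) : domain A :=
  Sub (image_set (val x)) (mem_set (image_set_is_elt x)).

End AssociatedFunction.

Definition retraction (T : Type) (f : T -> T) : Prop := f \o f = f.

Definition fixed_points (T : Type) (f : T -> T) : set T := [set x | f x = x].

Definition finitary {d : Order.disp_t} {T : porderType d} (f : T -> T) : Prop :=
  algebraic (set_type (fixed_points f)).

(* Main.v *)
Require Import Defs.
From mathcomp Require Import all_boot all_order finmap.
From mathcomp Require Import boolp classical_sets.

(** For consistent [u] let [R(u) = {t | u r {t}}], the image of the closure of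
    [u]; it is a fixed point of [|r|].  Suprema of directed sets of fixed points
    are unions, so every fixed point [x] is the directed supremum of the [R(v)]
    with [v] a finite subset of [x].  If [v r v] then [v] is contained in [R(v)],
    which makes [R(v)] compact; condition (2) says that these compact elements
    suffice to generate every fixed point.  Conversely a compact fixed point [c]
    is a directed supremum of sets [R(v)], hence is itself some [R(v)] with [v]
    contained in [c], which forces [v r v].  Replacing [v] by the union of [v]
    and [w] turns (2) into (3). *)

(** * Entailment and deductive closure of finite sets *)

Section Entailment.
Context {A : infosys}.
Implicit Types (u v w : {fset A}) (x : set A).

Lemma bigfcup_fset1 v : (\bigcup_(s <- [seq [fset t] | t <- v]) s)%fset = v.
Proof.
apply/fsetP => t; rewrite big_map; apply/bigfcupP/idP => [[s]|tv].
  by rewrite andbT => sv; rewrite inE => /eqP ->.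
by exists t; rewrite ?tv ?inE.
Qed.

Lemma entails_comp v u w : entails u v -> entails v w -> entails u w.
Proof.
move=> uv vw; apply: (@entails_trans A u [:: v]) => [s|].
  by rewrite inE => /eqP ->.
by rewrite big_seq1.
Qed.

Lemma entails_fset1 u v : (forall t, t \in v -> entails u [fset t]%fset) ->
  entails u v.
Proof.
move=> uv; apply: (@entails_trans A u [seq [fset t]%fset | t <- v]).
  by move=> _ /mapP[t tv ->]; exact: uv.
by rewrite bigfcup_fset1; exact: entails_sub.
Qed.

Definition consistent u := ~ entails u [fset nabla]%fset.

(** For consistent [u], the least element of [|A|] containing [u]. *)
Definition deductive_closure u : set A := [set t | entails u [fset t]%fset]%classic.

Lemma sub_deductive_closure u : ([set` u] `<=` deductive_closure u)%classic.
Proof. by move=> t tu; apply: entails_sub; rewrite fsub1set. Qed.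

Lemma deductive_closure_is_elt u : consistent u -> is_elt (deductive_closure u).
Proof.
move=> uC; split=> // v w vu vw t tw; apply: (entails_comp v).
  by apply: entails_fset1 => s /vu.
by apply: entails_comp vw _; apply: entails_sub; rewrite fsub1set.
Qed.

Lemma elt_consistent x u : is_elt x -> ([set` u] `<=` x)%classic -> consistent u.
Proof.
by move=> [xN xcl] ux uN; apply/xN/(xcl _ _ ux uN); rewrite /= inE.
Qed.

Lemma inconsistentE u v : ~ consistent u -> entails u v.
Proof.
by move=> /contrapT uN; apply: entails_comp uN _; exact: entails_nabla.
Qed.

(** Induction on [u]: all tokens but [t] lie in one member, [t] lies in another, and directedness
    gives a member above both. *)
Lemma fset_sub_directed_bigcup (I : Type) (D : set I) (f : I -> set A) u :
  (D !=set0)%classic ->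
  (forall i j, D i -> D j ->
     exists k, [/\ D k, f i `<=` f k & f j `<=` f k]%classic) ->
  ([set` u] `<=` \bigcup_(i in D) f i)%classic ->
  exists2 i, D i & ([set` u] `<=` f i)%classic.
Proof.
move=> [i0 Di0] Ddir; elim/finSet_rect: u => u IH uD.
have [->|[t tu]] := fset_0Vmem u; first by exists i0.
have [i Di ui] : exists2 i, D i & ([set` (u `\ t)%fset] `<=` f i)%classic.
  apply: IH => [|s /= su]; first exact: fproperD1.
  by apply: uD; move: su; rewrite /= !inE => /andP[].
have [j Dj tj] := uD _ tu.
have [k [Dk ik jk]] := Ddir _ _ Di Dj.
exists k => // s su; have [->|st] := eqVneq s t; first exact: jk.
by apply/ik/ui; rewrite /= !inE st.
Qed.

End Entailment.

(** * Images of finite sets under an approximable mapping *)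

Section Approximable.
Context {A : infosys} (r : approximable A).
Implicit Types (u v w : {fset A}) (x : set A).

Lemma amap_subl u v w : (u `<=` v)%fset -> r u w -> r v w.
Proof. by move=> uv ruw; apply: amap_entails ruw _; apply: entails_sub. Qed.

Lemma amap_subr u v w : (w `<=` v)%fset -> r u v -> r u w.
Proof. by move=> wv ruv; apply: amap_entails ruv _; apply: entails_sub. Qed.

Lemma amap_fset1 u v : (forall t, t \in v -> r u [fset t]%fset) -> r u v.
Proof.
move=> uv; rewrite -(bigfcup_fset1 v); apply: amap_bigcup => _ /mapP[t tv ->].
exact: uv.
Qed.

Lemma amapU u v w : r u v -> r u w -> r u (v `|` w)%fset.
Proof.
move=> ruv ruw; apply: amap_fset1 => t; rewrite inE => /orP[tv|tw].
  by apply: amap_subr ruv; rewrite fsub1set.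
by apply: amap_subr ruw; rewrite fsub1set.
Qed.

Lemma amap_inconsistent u v : ~ consistent u -> r u v.
Proof.
move=> uN; apply: (amap_entails (inconsistentE _ _ uN) (amap_nabla r)).
exact: entails_nabla.
Qed.

(** The set [R(u)] of the outline, defined for all [u] but an element of [|A|] only for consistent
    [u]. *)
Definition fset_image u : set A := [set t | r u [fset t]%fset]%classic.

(** Closure under finite unions on the right determines [r] by its values on singletons. For
    [u = v], the relation [r v v] thus means that [v] lies in [R(v)]. *)
Lemma sub_fset_image u v : ([set` v] `<=` fset_image u)%classic <-> r u v.
Proof.
split=> [vu|ruv t tv]; first exact: amap_fset1.
by apply: amap_subr ruv; rewrite fsub1set.
Qed.

(** A finite subset of the closure is entailed by [u], so whatever it is related to, [u] is related
    to as well. *)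
Lemma image_deductive_closure u :
  image_set r (deductive_closure u) = fset_image u.
Proof.
rewrite eqEsubset; split=> [t [v vu rvt]|t rut].
  apply: amap_entails rvt _; last exact: entails_sub.
  by apply: entails_fset1 => s /vu.
by exists u => //; exact: sub_deductive_closure.
Qed.

Lemma fset_image_mono u v : (u `<=` v)%fset ->
  (fset_image u `<=` fset_image v)%classic.
Proof. by move=> uv t; exact: amap_subl. Qed.

Lemma fset_image_sub x u : ([set` u] `<=` x)%classic ->
  (fset_image u `<=` image_set r x)%classic.
Proof. by move=> ux t rut; exists u. Qed.

Lemma interpolationE :
  (forall u w, r u w -> exists v, [/\ r u v, r v v & r v w]) <->
  (forall u w, r u w -> exists v, [/\ r u v, r v v & entails v w]).
Proof.
split=> H u w ruw; have [v [ruv rvv vw]] := H u w ruw.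
  exists (v `|` w)%fset; split; first exact: amapU.
    (* [v] is related to the union of [v] and [w], and enlarging the left argument preserves
       this. *)
    by apply: (@amap_subl v); [exact: fsubsetUl | exact: amapU].
  by apply: entails_sub; exact: fsubsetUr.
by exists v; split=> //; apply: amap_entails rvv vw; exact: entails_sub.
Qed.

End Approximable.

(** * Fixed points of the retraction and their directed suprema *)

Section FixedPoints.
Context {A : infosys} (r : approximable A).
Hypothesis r_retr : retraction (afun r).
Let fixpt := set_type (fixed_points (afun r)).
Implicit Types (u v w : {fset A}) (c x y : fixpt) (M : set fixpt).

Definition tokens x : set A := val (val x).

Lemma le_tokens x y : (x <= y)%O <-> (tokens x `<=` tokens y)%classic.
Proof. by rewrite -subsetEset. Qed.

Lemma tokens_is_elt x : is_elt (tokens x).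
Proof. exact: set_mem (valP (val x)). Qed.

Lemma image_tokens x : image_set r (tokens x) = tokens x.
Proof.
have fx : afun r (val x) = val x := set_mem (valP x).
exact: (congr1 val fx).
Qed.

Lemma fixpt_of_set (z : set A) : is_elt z -> image_set r z = z ->
  exists x, tokens x = z.
Proof.
move=> ze zfix.
pose a : domain A := Sub z (mem_set ze).
have aE : val a = z by rewrite SubK.
have afix : afun r a = a by apply: val_inj; rewrite SubK aE.
by exists (Sub a (mem_set (afix : fixed_points (afun r) a))); rewrite /tokens SubK.
Qed.

(** [R(u)] is the value of [|r|] at the closure of [u], and idempotence makes every value a fixed
    point. *)
Lemma fixpt_of_fset u : consistent u -> exists x, tokens x = fset_image r u.
Proof.
move=> uC.
pose a : domain A := Sub (deductive_closure u) (mem_set (deductive_closure_is_elt _ uC)).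
have aE : val (afun r a) = fset_image r u.
  by rewrite SubK SubK image_deductive_closure.
apply: fixpt_of_set; first by rewrite -aE; exact: set_mem (valP _).
by rewrite -aE; exact: (congr1 (fun f => val (f a)) r_retr).
Qed.

Lemma sub_tokens_consistent x u : ([set` u] `<=` tokens x)%classic ->
  consistent u.
Proof. exact/elt_consistent/tokens_is_elt. Qed.

Lemma fset_image_sub_tokens x u : ([set` u] `<=` tokens x)%classic ->
  (fset_image r u `<=` tokens x)%classic.
Proof. by rewrite -[in X in _ -> X]image_tokens; exact: fset_image_sub. Qed.

Lemma fset_sub_directed M u : directed M ->
  ([set` u] `<=` \bigcup_(m in M) tokens m)%classic ->
  exists2 m, M m & ([set` u] `<=` tokens m)%classic.
Proof.
move=> [M0 Mdir]; apply: fset_sub_directed_bigcup => // x y Mx My.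
by have [z [Mz /le_tokens ? /le_tokens ?]] := Mdir _ _ Mx My; exists z.
Qed.

(** Entailment and [|r|] only inspect finite subsets, and each finite subset of the union lies in a
    single member, itself a fixed point. *)
Lemma fixpt_of_directed M : directed M ->
  exists x, tokens x = (\bigcup_(m in M) tokens m)%classic.
Proof.
move=> Mdir; apply: fixpt_of_set.
  split=> [[m _]|u v /(fset_sub_directed _ _ Mdir)[m Mm um] uv t tv].
    by have [] := tokens_is_elt m.
  exists m => //; have [_ mcl] := tokens_is_elt m; exact: mcl um uv _ tv.
rewrite eqEsubset; split=> [t [u]|t [m Mm]].
  move=> /(fset_sub_directed _ _ Mdir)[m Mm um] rut; exists m => //.
  exact: fset_image_sub_tokens um _ rut.
rewrite -image_tokens => -[u um rut].
by exists u => // s su; exists m => //; exact: um.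
Qed.

Lemma supremum_bigcup M x :
  tokens x = (\bigcup_(m in M) tokens m)%classic -> supremums M x.
Proof.
move=> xE; split=> [m Mm|y My].
  by apply/le_tokens; rewrite xE => t mt; exists m.
apply/le_tokens; rewrite xE => t [m Mm mt].
by have /le_tokens := My _ Mm; exact.
Qed.

(** The union is itself a fixed point bounding [M], so the least upper bound lies inside it. *)
Lemma tokens_supremum M x : directed M -> supremums M x ->
  tokens x = (\bigcup_(m in M) tokens m)%classic.
Proof.
move=> /fixpt_of_directed[y yE] [xub xleast].
have [yub _] := supremum_bigcup _ _ yE.
rewrite eqEsubset; split=> [|t [m Mm]]; last exact: (le_tokens _ _).1 (xub _ Mm) t.
by rewrite -yE; apply/le_tokens/xleast.
Qed.

Lemma dcpo_fixpt : dcpo fixpt.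
Proof.
by move=> M /fixpt_of_directed[x xE]; exists x; exact: supremum_bigcup.
Qed.

(** * Compact fixed points *)

Lemma compact_fset_image c v :
  r v v -> tokens c = fset_image r v -> compact_elt c.
Proof.
move=> rvv cE M s Mdir Ms /le_tokens; rewrite (tokens_supremum _ _ Mdir Ms) => cM.
(* Being finite, [v] lies in one member [m], and the fixed point [m] then contains [R(v)]. *)
have [|m Mm vm] := fset_sub_directed M v Mdir.
  by apply: subset_trans cM; rewrite cE; apply/sub_fset_image.
by exists m => //; apply/le_tokens; rewrite cE; exact: fset_image_sub_tokens.
Qed.

(** Stated by an equation on tokens because [R(v)] is a fixed point only for consistent [v]; finite
    subsets of [x] are consistent. *)
Definition fset_images_below x : set fixpt :=
  [set y | exists2 v, ([set` v] `<=` tokens x)%classic &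
                      tokens y = fset_image r v]%classic.

Lemma directed_fset_images_below x : directed (fset_images_below x).
Proof.
split=> [|y y' [v vx yE] [w wx y'E]].
  have x0 : ([set` fset0 : {fset A}] `<=` tokens x)%classic.
    by move=> t; rewrite /= inE.
  by have [y yE] := fixpt_of_fset _ (sub_tokens_consistent _ _ x0); exists y, fset0.
have vwx : ([set` (v `|` w)%fset] `<=` tokens x)%classic.
  by move=> t; rewrite /= inE => /orP[/vx|/wx].
have [z zE] := fixpt_of_fset _ (sub_tokens_consistent _ _ vwx).
exists z; split; first by exists (v `|` w)%fset.
  by apply/le_tokens; rewrite zE yE; apply/fset_image_mono/fsubsetUl.
by apply/le_tokens; rewrite zE y'E; apply/fset_image_mono/fsubsetUr.
Qed.

Lemma supremum_fset_images_below x : supremums (fset_images_below x) x.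
Proof.
apply: supremum_bigcup; rewrite eqEsubset; split=> [t|t [y [v vx ->]]].
  rewrite -[in X in X -> _]image_tokens => -[v vx rvt].
  have [y yE] := fixpt_of_fset _ (sub_tokens_consistent _ _ vx).
  by exists y; [exists v | rewrite yE].
exact: fset_image_sub_tokens.
Qed.

Lemma compact_fixptP c : compact_elt c ->
  exists2 v, r v v & tokens c = fset_image r v.
Proof.
(* Compactness is applied to the family of all [R(v)] below [c], whose supremum is [c] itself. *)
move=> cK; have [y [v vc yE] /le_tokens cy] := cK _ _
  (directed_fset_images_below c) (supremum_fset_images_below c) (Order.POrderTheory.lexx c).
have cE : tokens c = fset_image r v.
  by rewrite eqEsubset; split; [rewrite -yE | exact: fset_image_sub_tokens].
by exists v => //; apply/sub_fset_image; rewrite -cE.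
Qed.

(** * Finitary retractions and interpolation *)

Lemma finitary_interpolation : finitary (afun r) ->
  forall u w, r u w -> exists v, [/\ r u v, r v v & r v w].
Proof.
move=> [_ alg] u w ruw; have [uC|uN] := pselect (consistent u); last first.
  (* For inconsistent [u] the witness is [{nabla}], which is related to every finite set. *)
  exists [fset nabla]%fset; split; [exact: amap_inconsistent|exact: amap_nabla|].
  by apply: amap_entails (amap_nabla r) _; exact: entails_nabla.
(* [w] lies in [x = R(u)], hence in one compact [c = R(v)] below [x] with [r v v]; then [v] lies in
   [c], so in [R(u)]. *)
have [x xE] := fixpt_of_fset _ uC; have [Kdir Ksup] := alg x.
have [|c [cK /le_tokens cx] wc] := fset_sub_directed _ w Kdir.
  by rewrite -(tokens_supremum _ _ Kdir Ksup) xE; apply/sub_fset_image.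
have [v rvv cE] := compact_fixptP _ cK.
exists v; split=> //; apply/sub_fset_image; last by rewrite -cE.
by rewrite -xE; apply: subset_trans cx; rewrite cE; apply/sub_fset_image.
Qed.

Lemma interpolation_finitary :
  (forall u w, r u w -> exists v, [/\ r u v, r v v & r v w]) ->
  finitary (afun r).
Proof.
move=> H; split=> [|x]; first exact: dcpo_fixpt.
(* Interpolating between a finite part of [x] and [u] gives [v] with [r v v]; the compact [R(v)]
   contains [u] and lies below [x]. *)
have below u : ([set` u] `<=` tokens x)%classic ->
    exists2 y, compacts_below x y & ([set` u] `<=` tokens y)%classic.
  rewrite -[in X in X -> _]image_tokens => /image_set_finite[u' u'x ru'u].
  have [v [ru'v rvv rvu]] := H _ _ ru'u.
  have vx : ([set` v] `<=` tokens x)%classic.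
    apply: subset_trans (fset_image_sub_tokens _ _ u'x).
    exact/sub_fset_image.
  have [y yE] := fixpt_of_fset _ (sub_tokens_consistent _ _ vx).
  exists y; last by rewrite yE; apply/sub_fset_image.
  split; first exact: compact_fset_image yE.
  by apply/le_tokens; rewrite yE; exact: fset_image_sub_tokens.
split.
  split=> [|a b [aK /le_tokens ax] [bK /le_tokens bx]].
    by have [|y yx _] := below fset0; [move=> t; rewrite /= inE | exists y].
  (* With [a = R(v)] and [b = R(w)], any fixed point containing both [v] and [w] is above [a] and
     [b]. *)
  have [v rvv aE] := compact_fixptP _ aK; have [w rww bE] := compact_fixptP _ bK.
  have va : ([set` v] `<=` tokens a)%classic by rewrite aE; apply/sub_fset_image.
  have wb : ([set` w] `<=` tokens b)%classic by rewrite bE; apply/sub_fset_image.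
  have [|y yx vwy] := below (v `|` w)%fset.
    by move=> t; rewrite /= inE => /orP[/va/ax|/wb/bx].
  exists y; split=> //; apply/le_tokens.
    rewrite aE; apply: fset_image_sub_tokens => t tv; apply: vwy.
    by rewrite /= inE; apply/orP; left.
  rewrite bE; apply: fset_image_sub_tokens => t tw; apply: vwy.
  by rewrite /= inE; apply/orP; right.
apply: supremum_bigcup; rewrite eqEsubset; split=> [t xt|t [c [_ /le_tokens]]].
  have [|y yx ty] := below [fset t]%fset.
    by move=> s; rewrite /= inE => /eqP ->.
  by exists y => //; apply: ty; rewrite /= inE.
exact.
Qed.

End FixedPoints.

Theorem lemma8p1p3 (A : infosys) (r : approximable A)
    (hr : retraction (afun r)) :
  (finitary (afun r) <->
   (forall u w : {fset A}, r u w ->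
      exists v : {fset A}, [/\ r u v, r v v & r v w])) /\
  (finitary (afun r) <->
   (forall u w : {fset A}, r u w ->
      exists v : {fset A}, [/\ r u v, r v v & entails v w])).
Proof.
have fin : finitary (afun r) <->
    (forall u w, r u w -> exists v, [/\ r u v, r v v & r v w]).
  by split; [exact: finitary_interpolation | exact: interpolation_finitary].
split=> //; exact: iff_trans fin (interpolationE r).
Qed.
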